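(* Let $\Phi$ be a random dynamical system on a separable Banach space $\mathbb{X}$ over a metric dynamical system $(\Omega,\mathcal{F},P,(\theta_t)_{t\in\mathbb{R}})$, and suppose that $\Phi$ has a random periodic path $Y$ of period $\tau>0$. Let $\mu_s$, $s\in\mathbb{R}$, be the measures on $(\bar\Omega,\bar{\mathcal{F}})=(\Omega\times\mathbb{X},\mathcal{F}\otimes\mathcal{B}(\mathbb{X}))$ given by $\mu_s(A)=\int_\Omega\delta_{Y(s,\omega)}(A_{\theta_s\omega})P(d\omega)$, let $(\bar\Theta_t)_{t\ge0}$ be the skew product, and let $\mathbb{E}[\varphi]=\sup_{s\in[0,\tau)}E_{\mu_s}[\varphi]$ for $\varphi\in L_b(\bar\Omega)$. Suppose $(\bar\Omega,\bar{\mathcal{F}},\mu_s,(\bar\Theta_\tau^n)_{n\ge0})$ is ergodic for some $s\in\mathbb{R}$. Then for any $\xi\in L_b(\bar\Omega)$, $$\lim_{T\to\infty}\frac1T\int_0^TU_t\xi\,dt=\frac1\tau\int_0^\tau E_{\mu_s}[\xi]\,ds,\quad\mathbb{E}\text{-q.s.},$$ where $(U_t\xi)(\omega,x)=\xi(\bar\Theta_t(\omega,x))$.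
   Context: Metric dynamical system: a probability space $(\Omega,\mathcal{F},P)$ with a jointly measurable map $\theta:\mathbb{R}\times\Omega\to\Omega$ such that $\theta_0=\mathrm{id}$, $\theta_t\circ\theta_s=\theta_{t+s}$ and $\theta_tP=P$ for all $s,t\in\mathbb{R}$. Random dynamical system: a measurable map $\Phi:\mathbb{R}^+\times\Omega\times\mathbb{X}\to\mathbb{X}$ such that, almost surely, $\Phi(0,\omega)=\mathrm{id}$ and $\Phi(t+s,\omega)=\Phi(t,\theta_s\omega)\circ\Phi(s,\omega)$ for all $t,s\ge0$. Random periodic path of period $\tau$: a measurable map $Y:\mathbb{R}\times\Omega\to\mathbb{X}$ such that for almost all $\omega$, $\Phi(t,\theta_s\omega)Y(s,\omega)=Y(t+s,\omega)$ and $Y(s+\tau,\omega)=Y(s,\theta_\tau\omega)$ for all $t\ge0$, $s\in\mathbb{R}$. Skew product: $\bar\Theta_t(\omega,x)=(\theta_t\omega,\Phi(t,\omega)x)$, $t\ge 0$. $A_\omega=\{x:(\omega,x)\in A\}$. It is known that $\mu_{s+\tau}=\mu_s$ and $\bar\Theta_t\mu_s=\mu_{t+s}$ for $t\ge0,s\in\mathbb{R}$. $L_b(\bar\Omega)$ is the set of bounded measurable $\varphi:\bar\Omega\to\mathbb{R}$, and $E_{\mu_s}[\varphi]=\int\varphi\,d\mu_s=\int_\Omega\varphi(\omega,Y(s,\theta_{-s}\omega))P(d\omega)$. $(\bar\Omega,\bar{\mathcal{F}},\mu_s,(\bar\Theta_\tau^n)_{n\ge0})$ is ergodic if $A\in\bar{\mathcal{F}}$,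 $\bar\Theta_\tau^{-1}A=A$ imply $\mu_s(A)\in\{0,1\}$. A statement holds $\mathbb{E}$-quasi surely ($\mathbb{E}$-q.s.) if it is true on a set $A$ with $\mathbb{E}[I_{A^c}]=0$. *)

(* Defs.v *)
From HB Require Import structures.
From mathcomp Require Import all_boot all_order all_algebra.
From mathcomp Require Import all_classical all_reals all_analysis.
Import Order.TTheory GRing.Theory Num.Theory.
Import numFieldNormedType.Exports.

Set Implicit Arguments.
Unset Strict Implicit.
Unset Printing Implicit Defensive.

Local Open Scope classical_set_scope.
Local Open Scope ring_scope.

Notation borel X := (g_sigma_algebraType (@open X)).

Definition separable (X : topologicalType) : Prop :=
  exists2 D : set X, countable D & dense D.

Record metric_dynamical_system d (Omega : measurableType d) (R : realType)
    (P : probability Omega R) := MetricDynamicalSystem {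
  shift :> R -> Omega -> Omega ;
  measurable_shift :
    measurable_fun [set: R * Omega] (fun p : R * Omega => shift p.1 p.2) ;
  shift0 : forall w, shift 0 w = w ;
  shiftD : forall t s w, shift t (shift s w) = shift (t + s) w ;
  shift_preserves : forall t (A : set Omega), measurable A ->
    pushforward P (shift t) A = P A }.

(* Time R^+ is encoded by a total function of t : R whose values at t < 0 are
   irrelevant: measurability is only required on t >= 0. The exceptional null
   set of w does not depend on t, s or x. *)
Record random_dynamical_system d (Omega : measurableType d) (R : realType)
    (P : probability Omega R) (theta : metric_dynamical_system P)
    (X : completeNormedModType R) := RandomDynamicalSystem {
  flow :> R -> Omega -> X -> X ;
  measurable_flow :
    measurable_fun [set p : R * Omega * borel X | 0 <= p.1.1]
      (fun p : R * Omega * borel X => flow p.1.1 p.1.2 p.2 : borel X) ;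
  flow_cocycle : {ae P, forall w,
    flow 0 w = id /\
    forall t s, 0 <= t -> 0 <= s ->
      flow (t + s) w = flow t (theta s w) \o flow s w} }.

Record random_periodic_path d (Omega : measurableType d) (R : realType)
    (P : probability Omega R) (theta : metric_dynamical_system P)
    (X : completeNormedModType R) (Phi : random_dynamical_system theta X)
    (tau : R) := RandomPeriodicPath {
  rpath :> R -> Omega -> X ;
  measurable_rpath :
    measurable_fun [set: R * Omega]
      (fun p : R * Omega => rpath p.1 p.2 : borel X) ;
  rpath_periodic : {ae P, forall w,
    (forall t s, 0 <= t -> Phi t (theta s w) (rpath s w) = rpath (t + s) w) /\
    (forall s, rpath (s + tau) w = rpath s (theta tau w))} }.

Section periodic_measures.
Context d (Omega : measurableType d) (R : realType) (P : probability Omega R).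
Context (theta : metric_dynamical_system P) (X : completeNormedModType R).
Context (Phi : random_dynamical_system theta X) (tau : R).
Implicit Types (Y : random_periodic_path Phi tau) (phi : Omega * borel X -> R).

Definition skew_product (t : R) (p : Omega * borel X) : Omega * borel X :=
  (theta t p.1, Phi t p.1 p.2).

Definition koopman (t : R) phi : Omega * borel X -> R :=
  phi \o skew_product t.

Definition periodic_measure Y (s : R) (A : set (Omega * borel X)) : \bar R :=
  (\int[P]_w (dirac (Y s w : borel X) (xsection A (theta s w)) : \bar R))%E.

Lemma measurable_orbit Y s : measurable_fun [set: Omega]
  (fun w => (theta s w, Y s w) : Omega * borel X).
Proof.
apply: measurable_fun_pair.
- exact: (measurableT_comp (measurable_shift theta) (pair1_measurable s)).
- exact: (measurableT_comp (measurable_rpath Y) (pair1_measurable s)).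
Qed.

Lemma periodic_measureE Y s A : measurable A ->
  periodic_measure Y s A =
    pushforward P (fun w => (theta s w, Y s w) : Omega * borel X) A.
Proof.
move=> mA; rewrite /periodic_measure /pushforward.
set g := (fun w => (theta s w, Y s w) : Omega * borel X).
rewrite -[g @^-1` A]setIT -integral_indic//; last first.
  by rewrite -[X in measurable X]setTI; exact: measurable_orbit.
apply: eq_integral => w _; rewrite /dirac !indicE mem_xsection.
by congr ((nat_of_bool _)%:R%:E); apply/idP/idP; rewrite !inE.
Qed.

Let periodic_measure0 Y s : periodic_measure Y s set0 = 0%E.
Proof. by rewrite periodic_measureE// /pushforward preimage_set0 measure0. Qed.

Let periodic_measure_ge0 Y s A : (0 <= periodic_measure Y s A)%E.
Proof. exact: integral_ge0. Qed.

Let periodic_measure_sigma_additive Y s :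
  semi_sigma_additive (periodic_measure Y s).
Proof.
move=> F mF tF mUF; rewrite periodic_measureE//.
under eq_fun do under eq_bigr do rewrite periodic_measureE//.
exact: (@measure_semi_sigma_additive _ _ _
  (measure_function_pushforward__canonical__measure_function_Measure
    P (measurable_orbit Y s))).
Qed.

HB.instance Definition _ Y s := isMeasure.Build _ _ _ (periodic_measure Y s)
  (periodic_measure0 Y s) (periodic_measure_ge0 Y s)
  (@periodic_measure_sigma_additive Y s).

Definition periodic_mean Y (s : R) phi : R :=
  \int[periodic_measure Y s]_p phi p.

Definition upper_expectation Y phi : R :=
  sup [set periodic_mean Y s phi | s in `[0, tau[].

Definition quasi_surely Y (Q : Omega * borel X -> Prop) : Prop :=
  exists A : set (Omega * borel X),
    [/\ measurable A, upper_expectation Y \1_(~` A) = 0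
      & forall p, A p -> Q p].

End periodic_measures.

Definition ergodic d (T : measurableType d) (R : realType)
    (m : {measure set T -> \bar R}) (f : T -> T) : Prop :=
  forall A : set T, measurable A -> f @^-1` A = A ->
    m A = 0%E \/ m A = 1%E.

Definition bounded_measurable d (T : measurableType d) (R : realType)
    (f : T -> R) : Prop :=
  measurable_fun [set: T] f /\ bounded_fun f.

(* Main.v *)
(* A periodic path gives orbits g_s(w) = (theta_s w, Y(s, w)) with
   Theta_t g_s = g_(t+s) and g_(s+tau) = g_s o theta_tau almost surely. The
   average G of xi over one period turns continuous time averages into Birkhoff
   averages of G under Theta_tau, which converge mu_s0-almost surely by
   Birkhoff's theorem at the ergodic time s0. Along a single orbit the averages
   started at times s0 and s differ by O(1/n), so convergence holds
   mu_s-almost surely for every s, on one set of points independent of s. Fubini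
   and the periodicity of s |-> mu_s identify the limit. *)
From HB Require Import structures.
Require Import Defs.
From mathcomp Require Import all_boot all_order all_algebra.
From mathcomp Require Import all_classical all_reals all_analysis.
From mathcomp Require Import measurable_realfun.
From mathcomp Require Import ring lra.
Import Order.TTheory GRing.Theory Num.Theory.
Import numFieldNormedType.Exports.

Set Implicit Arguments.
Unset Strict Implicit.
Unset Printing Implicit Defensive.

Local Open Scope classical_set_scope.
Local Open Scope ring_scope.

(** * Bounded measurable functions *)

Section bounded_measurable.
Context d (T : measurableType d) (R : realType).
Implicit Types f g : T -> R.

Lemma bounded_measurableP f : bounded_measurable f <->
  measurable_fun [set: T] f /\ exists M, forall x, `|f x| <= M.
Proof.
split=> -[mf bf]; split=> //.
  (* [bounded_fun] bounds [|f|] only by numbers strictly above its [M], whence the extra 1. *)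
  have [M [_ hM]] := bf; exists (M + 1) => x.
  by apply: hM => //; rewrite ltrDl.
have [M hM] := bf; exists M; split; first exact: num_real.
by move=> N MN x _; exact: (le_trans (hM x) (ltW MN)).
Qed.

Lemma bounded_measurable_integrable (m : {measure set T -> \bar R})
    (D : set T) f :
  measurable D -> (m D < +oo)%E -> bounded_measurable f ->
  m.-integrable D (EFin \o f).
Proof.
move=> mD mDoo [mf bf]; apply: measurable_bounded_integrable => //.
- exact: measurable_funTS.
- have [M [Mr hM]] := bf; exists M; split=> // N MN x _; exact: hM.
Qed.

Lemma bounded_measurable_cst (c : R) : bounded_measurable (cst c : T -> R).
Proof. by apply/bounded_measurableP; split=> //; exists `|c|. Qed.

Lemma bounded_measurableD f g : bounded_measurable f -> bounded_measurable g ->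
  bounded_measurable (f \+ g).
Proof.
move=> /bounded_measurableP[mf [M hM]] /bounded_measurableP[mg [N hN]].
apply/bounded_measurableP; split; first exact: measurable_funD.
by exists (M + N) => x; rewrite (le_trans (ler_normD _ _))// lerD.
Qed.

Lemma bounded_measurableN f : bounded_measurable f ->
  bounded_measurable (\- f).
Proof.
move=> /bounded_measurableP[mf [M hM]]; apply/bounded_measurableP; split.
  exact: measurableT_comp.
by exists M => x; rewrite normrN.
Qed.

Lemma bounded_measurable_maxr f g :
  bounded_measurable f -> bounded_measurable g ->
  bounded_measurable (fun x => Num.max (f x) (g x)).
Proof.
move=> /bounded_measurableP[mf [M hM]] /bounded_measurableP[mg [N hN]].
apply/bounded_measurableP; split; first exact: measurable_maxr.
exists (Num.max M N) => x; rewrite /Num.max; case: ifP => _; case: ifP => MN.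
- exact: hN.
- by rewrite (le_trans (hN x))// leNgt MN.
- by rewrite (le_trans (hM x))// ltW.
- exact: hM.
Qed.

Lemma bounded_measurable_sum n (F : nat -> T -> R) :
  (forall i, bounded_measurable (F i)) ->
  bounded_measurable (fun x => \sum_(i < n) F i x).
Proof.
move=> bF; elim: n => [|n IHn].
  rewrite (_ : (fun _ => _) = cst 0); first exact: bounded_measurable_cst.
  by apply/funext => x; rewrite big_ord0.
rewrite (_ : (fun _ => _) = (fun x => \sum_(i < n) F i x) \+ F n).
  exact: bounded_measurableD.
by apply/funext => x; rewrite big_ord_recr.
Qed.

End bounded_measurable.

Lemma bounded_measurable_comp d d' (T : measurableType d)
    (T' : measurableType d') (R : realType) (f : T' -> R) (g : T -> T') :
  measurable_fun [set: T] g -> bounded_measurable f ->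
  bounded_measurable (f \o g).
Proof.
move=> mg /bounded_measurableP[mf [M hM]]; apply/bounded_measurableP.
by split; [exact: measurableT_comp|exists M => x; exact: hM].
Qed.

(** * Birkhoff's ergodic theorem for bounded functions *)

Section birkhoff.
Context d (T : measurableType d) (R : realType) (m : probability T R).
Variables (S : T -> T) (mS : measurable_fun [set: T] S).
Hypothesis m_preserved : forall A, measurable A -> m (S @^-1` A) = m A.
Implicit Types f : T -> R.

Let integrable f : bounded_measurable f -> m.-integrable [set: T] (EFin \o f).
Proof.
apply: bounded_measurable_integrable => //.
exact: le_lt_trans (probability_le1 m measurableT) (ltry _).
Qed.

Lemma Rintegral_preserved f : bounded_measurable f ->
  \int[m]_x f (S x) = \int[m]_x f x.
Proof.
move=> bf; have [mf _] := bf; rewrite /Rintegral; congr fine.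
have := @integral_pushforward _ _ _ _ _ _ mS m setT (EFin \o f).
rewrite preimage_setT => <-//.
- by apply: eq_measure_integral => A mA _; exact: m_preserved.
- exact/measurable_EFinP.
- by apply: (@integrable (f \o S)); exact: bounded_measurable_comp.
Qed.

Definition birkhoff_sum f n x : R := \sum_(k < n) f (iter k S x).

Lemma birkhoff_sumS f n x :
  birkhoff_sum f n.+1 x = f x + birkhoff_sum f n (S x).
Proof.
rewrite /birkhoff_sum big_ord_recl /=; congr (_ + _).
by apply: eq_bigr => k _; rewrite -iterSr.
Qed.

Lemma measurable_iter n : measurable_fun [set: T] (iter n S).
Proof. elim: n => [|n IHn]; first exact: measurable_id.
exact: (measurableT_comp mS IHn). Qed.

Lemma bounded_measurable_birkhoff_sum f n : bounded_measurable f ->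
  bounded_measurable (birkhoff_sum f n).
Proof.
move=> bf; apply: (@bounded_measurable_sum _ _ _ _ (fun k => f \o iter k S)).
by move=> k; apply: bounded_measurable_comp => //; exact: measurable_iter.
Qed.

(* The running maximum of [0], ..., [birkhoff_sum f n], in Garsia's recursive
   form. *)
Fixpoint birkhoff_max f n x : R :=
  if n is n'.+1 then Num.max 0 (f x + birkhoff_max f n' (S x)) else 0.

Lemma birkhoff_max_ge0 f n x : 0 <= birkhoff_max f n x.
Proof. by case: n => [|n] //=; rewrite le_max lexx. Qed.

Lemma birkhoff_max_leS f n x : birkhoff_max f n x <= birkhoff_max f n.+1 x.
Proof.
elim: n x => [|n IHn] x; first exact: birkhoff_max_ge0.
rewrite [leRHS]/= [leLHS]/= ge_max !le_max lexx /=.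
by apply/orP; right; rewrite lerD2l.
Qed.

Lemma birkhoff_sum_le_max f n x : birkhoff_sum f n x <= birkhoff_max f n x.
Proof.
elim: n x => [|n IHn] x; first by rewrite /birkhoff_sum big_ord0.
by rewrite birkhoff_sumS /= le_max lerD2l IHn orbT.
Qed.

Lemma bounded_measurable_birkhoff_max f n : bounded_measurable f ->
  bounded_measurable (birkhoff_max f n).
Proof.
move=> bf; elim: n => [|n IHn]; first exact: bounded_measurable_cst.
apply: bounded_measurable_maxr; first exact: bounded_measurable_cst.
by apply: bounded_measurableD => //; exact: bounded_measurable_comp.
Qed.

Let nonpos f n := [set x | birkhoff_max f n x <= 0].

Let measurable_nonpos f n : bounded_measurable f -> measurable (nonpos f n).
Proof.
move=> /(@bounded_measurable_birkhoff_max _ n)[mM _].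
have := mM measurableT _ (measurable_itv `]-oo, (0:R)]).
by rewrite setTI; congr (measurable _); apply/seteqP; split => x /=;
  rewrite in_itv.
Qed.

(** Garsia's argument. Where the maximum is positive, [f] equals [birkhoff_max f n.+1 - birkhoff_max
    f n \o S]; elsewhere this difference is at most 0 and [f >= - C]. Integrating over the whole
    space, the bad set costs only [C] times its measure. *)
Lemma maximal_inequality f n C : bounded_measurable f ->
  (forall x, `|f x| <= C) ->
  - C * fine (m [set x | birkhoff_max f n.+1 x <= 0]) <= \int[m]_x f x.
Proof.
move=> bf fC; rewrite -/(nonpos f n.+1).
have mE := measurable_nonpos n.+1 bf.
have C0 : 0 <= C := le_trans (normr_ge0 _) (fC point).
have bM k := bounded_measurable_birkhoff_max k bf.
have bMS k := bounded_measurable_comp mS (bM k).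
have bE : bounded_measurable (\1_(nonpos f n.+1) : T -> R).
  apply/bounded_measurableP; split; first exact: measurable_indic.
  exists 1 => x; rewrite indicE; case: (_ \in _); first by rewrite normr1.
  by rewrite normr0.
have bCE : bounded_measurable (fun x => - C * \1_(nonpos f n.+1) x : R).
  apply/bounded_measurableP; split; first by apply: measurable_funM; case: bE.
  exists C => x; rewrite normrM normrN (ger0_norm C0) indicE.
  by case: (_ \in _); rewrite ?normr1 ?normr0 ?mulr1 ?mulr0.
have -> : - C * fine (m (nonpos f n.+1)) =
    \int[m]_x (- C * \1_(nonpos f n.+1) x).
  rewrite RintegralZl//; last exact: integrable.
  by rewrite /Rintegral integral_indic// setIT.
have bB := bounded_measurableD (bM n.+1) (bounded_measurableN (bMS n)).
(* The added 0 is a lower bound for the integral of [birkhoff_max f n.+1 - birkhoff_max f n \o S],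
   by invariance of [m] and monotonicity in [n]. *)
rewrite -[leLHS]add0r.
apply: (@le_trans _ _ (\int[m]_x ((birkhoff_max f n.+1 x -
    birkhoff_max f n (S x)) + - C * \1_(nonpos f n.+1) x))).
  rewrite RintegralD//; [|exact: integrable bB|exact: integrable bCE].
  rewrite lerD2r RintegralB//; last 2 first.
  - exact: integrable (bM _).
  - exact: integrable (bMS _).
  rewrite subr_ge0 Rintegral_preserved//.
  apply: le_Rintegral => //; [exact: integrable (bM _)..|] => x _.
  exact: birkhoff_max_leS.
apply: le_Rintegral => //.
- by apply: integrable; exact: bounded_measurableD.
- exact: integrable.
move=> x _; rewrite indicE.
have := birkhoff_max_ge0 f n (S x).
have [xE|] := boolP (x \in nonpos f n.+1).
  move: xE (fC x); rewrite inE /nonpos /= => M0.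
  rewrite ler_norml => /andP[+ _].
  by rewrite mulr1; lra.
(* A positive maximum must come from the second branch of the recursion, which gives equality
   here. *)
rewrite notin_setE /nonpos /= => /negP; rewrite -ltNge mulr0 addr0.
by rewrite /Num.max; case: ifP => _; [lra|rewrite ltxx].
Qed.

(** The sets where the running maximum is nonpositive decrease, and at a point of their intersection
    no sum is positive, so the intersection is null. The error term of [maximal_inequality] vanishes
    in the limit. *)
Lemma maximal_ergodic f : bounded_measurable f ->
  {ae m, forall x, exists n, 0 < birkhoff_sum f n x} -> 0 <= \int[m]_x f x.
Proof.
move=> bf aepos; have [mf [C fC]] := (bounded_measurableP _).1 bf.
have mE n := measurable_nonpos n bf.
have cvgE : m (nonpos f n.+1) @[n --> \oo] --> m (\bigcap_n nonpos f n.+1).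
  apply: nonincreasing_cvg_mu => //.
  - exact: le_lt_trans (probability_le1 m (mE 1%N)) (ltry _).
  - exact: bigcap_measurable.
  - apply/nonincreasing_seqP => n; apply/subsetPset => x; rewrite /nonpos.
    exact/le_trans/birkhoff_max_leS.
have E0 : m (\bigcap_n nonpos f n.+1) = 0%E.
  apply: measure_negligible; first exact: bigcap_measurable.
  apply: negligibleS aepos => x Ex [n]; rewrite ltNge => /negP; apply.
  rewrite (le_trans (birkhoff_sum_le_max f n x))//.
  by rewrite (le_trans (birkhoff_max_leS f n x))//; exact: Ex.
rewrite E0 in cvgE.
have cvgf : - C * fine (m (nonpos f n.+1)) @[n --> \oo] --> - C * 0.
  by apply: cvgMr; exact: (fine_cvg cvgE).
rewrite mulr0 in cvgf; rewrite -(cvg_lim _ cvgf)//.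
apply: limr_le; first by apply/cvg_ex; exists 0.
by near=> n; exact: maximal_inequality.
Unshelve. all: by end_near. Qed.

(* The set where the sums of [f - a] are unbounded above is strictly invariant,
   hence null when [a] exceeds the mean: were it of full measure, the maximal
   ergodic theorem would give [0 <= \int (f - a)]. *)
Lemma birkhoff_sum_bounded f a : ergodic m S -> bounded_measurable f ->
  \int[m]_x f x < a ->
  {ae m, forall x, exists K, forall n, birkhoff_sum f n x <= n%:R * a + K}.
Proof.
move=> erg bf fa; pose g := fun x => f x - a.
have bg : bounded_measurable g.
  exact: (bounded_measurableD bf (bounded_measurable_cst _ (- a))).
have gE n x : birkhoff_sum g n x = birkhoff_sum f n x - n%:R * a.
  by rewrite /birkhoff_sum sumrB sumr_const card_ord mulr_natl.
(* Natural thresholds suffice and make [E] a countable intersection of countable unions. *)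
pose E := [set x | forall K : nat, exists n, K%:R < birkhoff_sum g n x].
have mE : measurable E.
  rewrite (_ : E = \bigcap_K \bigcup_n (birkhoff_sum g n @^-1` `]K%:R, +oo[)).
    apply: bigcap_measurable => // K _; apply: bigcup_measurable => n _.
    have [mg _] := bounded_measurable_birkhoff_sum n bg.
    by rewrite -[X in measurable X]setTI; exact: mg.
  apply/seteqP; split => x Ex K.
    by move=> _; have [n Kn] := Ex K; exists n; rewrite //= in_itv/= andbT.
  have [n _] := Ex K I; rewrite /= in_itv/= andbT => Kn.
  by exists n.
have [_ [M gM]] := (bounded_measurableP g).1 bg.
(* The sums at [x] and at [S x] differ by one term of modulus at most [M], so a threshold above
   [K + M] at one point gives [K] at the other. *)
have SE : S @^-1` E = E.
  apply/seteqP; split => x /= Ex K.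
    have [n] := Ex (Num.bound (K%:R + M)).
    move/(lt_trans (archi_boundP _)) => KM.
    exists n.+1; rewrite birkhoff_sumS.
    have : - M <= g x by have := gM x; rewrite ler_norml => /andP[].
    have /KM : 0 <= K%:R + M by rewrite addr_ge0// (le_trans (normr_ge0 (g x))).
    by lra.
  (* The empty sum exceeds no natural number, so the index is a successor. *)
  have [[|n]] := Ex (Num.bound (K%:R + M)).
    by rewrite /birkhoff_sum big_ord0 ltrn0.
  move/(lt_trans (archi_boundP _)) => KM; exists n.
  have : g x <= M by have := gM x; rewrite ler_norml => /andP[].
  have /KM : 0 <= K%:R + M by rewrite addr_ge0// (le_trans (normr_ge0 (g x))).
  by rewrite birkhoff_sumS; lra.
have [E0|E1] := erg E mE SE; last first.
  suff : 0 <= \int[m]_x g x.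
    rewrite RintegralB//; last 2 first.
    - exact: integrable.
    - exact: (integrable (bounded_measurable_cst _ a)).
    rewrite Rintegral_cst// [X in fine X](probability_setT m) mulr1.
    by rewrite subr_ge0 leNgt fa.
  (* On [E], of full measure, the threshold 0 supplies the required positive sums. *)
  apply: maximal_ergodic => //; exists (~` E); split; first exact: measurableC.
    by rewrite probability_setC// E1 subee.
  by apply: subsetC => x /(_ 0%N).
exists E; split => // x; apply: contra_notP => xE.
have [K hK] : exists K : nat, forall n, birkhoff_sum g n x <= K%:R.
  move/existsNP : xE => [K hK]; exists K => n; rewrite leNgt.
  by apply/negP => Kn; apply: hK; exists n.
by exists K%:R => n; rewrite -lerBlDl -gE.
Qed.

(** The linear bounds for [f] and [- f], with [a] exceeding the mean by [1 / (k + 1)], leave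
    countably many null sets. Elsewhere the sums are within [n / (k + 1)] plus a constant of [n]
    times the mean. *)
Theorem birkhoff_ergodic f : ergodic m S -> bounded_measurable f ->
  {ae m, forall x, n%:R^-1 * birkhoff_sum f n x @[n --> \oo] -->
    \int[m]_x f x}.
Proof.
move=> erg bf; set c := \int[m]_x f x.
have bNf := bounded_measurableN bf.
have Nf : \int[m]_x (- f x) = - c.
  under eq_Rintegral do rewrite -mulN1r.
  by rewrite RintegralZl ?mulN1r//; exact: integrable.
have NfE n x : birkhoff_sum (\- f) n x = - birkhoff_sum f n x.
  by rewrite /birkhoff_sum sumrN.
have up k : {ae m, forall x, exists K, forall n,
    birkhoff_sum f n x <= n%:R * (c + k.+1%:R^-1) + K}.
  by apply: birkhoff_sum_bounded => //; rewrite ltrDl.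
have down k : {ae m, forall x, exists K, forall n,
    birkhoff_sum (\- f) n x <= n%:R * (- c + k.+1%:R^-1) + K}.
  by apply: birkhoff_sum_bounded => //; rewrite Nf ltrDl.
move: (ae_foralln up) (ae_foralln down); apply: filterS2 => x {}up {}down.
apply/cvgrPdist_le => e e0.
(* Half of [e] absorbs [1 / (k + 1)], the other half the constants divided by [n]. *)
have [k ke] : exists k : nat, k.+1%:R^-1 <= e / 2.
  exists (Num.bound (e / 2)^-1); rewrite invf_ple ?posrE ?divr_gt0//.
  have /ltW/le_trans : (e / 2)^-1 < (Num.bound (e / 2)^-1)%:R.
    by apply: archi_boundP; rewrite invr_ge0 divr_ge0// ltW.
  by apply; rewrite ler_nat.
have [K hK] := up k; have [L hL] := down k.
near=> n.
have n0 : 0 < n%:R :> R by near: n; exists 1%N => // j /=; rewrite ltr0n.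
have KLn : `|K| + `|L| <= n%:R * (e / 2).
  rewrite -ler_pdivrMr ?divr_gt0//; near: n; exact: nbhs_infty_ger.
have := hK n; have := hL n; rewrite NfE.
rewrite distrC ler_distl !(mulrC n%:R^-1) ler_pdivlMr// ler_pdivrMr//.
have : n%:R * k.+1%:R^-1 <= n%:R * (e / 2) by rewrite ler_pM2l.
have := ler_norm K; have := ler_norm L.
have := normr_ge0 K; have := normr_ge0 L.
rewrite !mulrDr; move: KLn.
set u := n%:R * k.+1%:R^-1; set v := n%:R * (e / 2).
have -> : (c - e) * n%:R = n%:R * c - 2 * v by rewrite /v; field.
have -> : (c + e) * n%:R = n%:R * c + 2 * v by rewrite /v; field.
by rewrite mulrN => *; apply/andP; split; lra.
Unshelve. all: by end_near. Qed.

End birkhoff.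

(** * Time averages of a bounded function on the line *)

Section time_averages.
Context (R : realType).
Local Notation mu := (@lebesgue_measure R).
Implicit Types f : R -> R.

(** By uniqueness of Lebesgue measure, translation invariance is checked on half-open intervals
    only. *)
Lemma lebesgue_measureDr (s : R) (A : set R) : measurable A ->
  pushforward mu (+%R^~ s : _ -> measurableTypeR R) A = mu A.
Proof.
move=> mA; apply/esym/lebesgue_measure_unique => //=.
  by apply: measurable_funD.
move=> ms _ [[a b]] _ <-.
rewrite /pushforward (_ : _ @^-1` _ = `]a - s, b - s]%classic); last first.
  by apply/seteqP; split => x /=; rewrite !in_itv/= ltrBlDr lerBrDr.
rewrite !lebesgue_measure_itv/= !lte_fin ltrBlDr subrK.
by rewrite -!EFinB opprB addrA subrK.
Qed.

Lemma integrable_itv f a b : bounded_measurable f ->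
  mu.-integrable `[a, b] (EFin \o f).
Proof.
move=> bf; apply: (@bounded_measurable_integrable _ _ R mu) => //.
by rewrite [ltLHS]lebesgue_measure_itv/=; case: ifP => _; rewrite ltry.
Qed.

Lemma bounded_measurable_addr f (s : R) : bounded_measurable f ->
  bounded_measurable (fun t : R => f (t + s)).
Proof.
apply: (@bounded_measurable_comp _ _ R R R f (+%R^~ s)).
by apply: measurable_funD.
Qed.

Lemma Rintegral_itv_addr f (s a b : R) : bounded_measurable f ->
  \int[mu]_(t in `[a, b]) f (t + s) = \int[mu]_(t in `[a + s, b + s]) f t.
Proof.
move=> bf; have [mf _] := bf; rewrite /Rintegral; congr fine.
have ms : measurable_fun [set: measurableTypeR R]
    (+%R^~ s : measurableTypeR R -> measurableTypeR R).
  by apply: measurable_funD.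
have E : (+%R^~ s : R -> R) @^-1` `[a + s, b + s] = `[a, b]%classic.
  by apply/seteqP; split => x /=; rewrite !in_itv/= !lerD2r.
have := @integral_pushforward _ _ _ _ _ _ ms mu `[a + s, b + s] (EFin \o f).
rewrite E => <-//; last 2 first.
- exact/measurable_EFinP.
- exact: (@integrable_itv (fun t => f (t + s)) a b
    (bounded_measurable_addr s bf)).
by apply: eq_measure_integral => A mA _; exact: lebesgue_measureDr.
Qed.

Lemma Rintegral_itv_cat f a b c : bounded_measurable f -> a <= b -> b <= c ->
  \int[mu]_(t in `[a, c]) f t =
  \int[mu]_(t in `[a, b]) f t + \int[mu]_(t in `[b, c]) f t.
Proof.
move=> bf ab bc; have fi := integrable_itv _ _ bf.
apply/eqP; rewrite addrC -subr_eq; apply/eqP.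
rewrite Rintegral_itvB ?bnd_simp// Rintegral_itv_obnd_cbnd//.
by apply: integrableS (fi b c) => //; exact: subset_itv_oc_cc.
Qed.

Lemma normr_Rintegral_itv f M a b : bounded_measurable f ->
  (forall t, `|f t| <= M) -> a <= b ->
  `|\int[mu]_(t in `[a, b]) f t| <= M * (b - a).
Proof.
move=> bf fM ab; have fi := integrable_itv a b bf.
apply: le_trans (le_normr_Rintegral _ fi) _ => //.
have -> : M * (b - a) = \int[mu]_(t in `[a, b]) M.
  rewrite Rintegral_cst// [X in fine X]lebesgue_measure_itv/= lte_fin.
  by case: ltP => //= ba; rewrite (@le_anti _ _ a b) ?ab// subrr.
apply: le_Rintegral => //.
- exact: integrable_norm.
- exact: (integrable_itv _ _ (bounded_measurable_cst _ M)).
Qed.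

Lemma Rintegral_itv_blocks f (tau : R) n : 0 <= tau -> bounded_measurable f ->
  \int[mu]_(t in `[0, n%:R * tau]) f t =
  \sum_(k < n) \int[mu]_(t in `[0, tau]) f (t + k%:R * tau).
Proof.
move=> tau0 bf; elim: n => [|n IHn].
  by rewrite big_ord0 mul0r set_itv1 Rintegral_set1.
rewrite big_ord_recr /= -IHn Rintegral_itv_addr// add0r.
rewrite (_ : tau + n%:R * tau = n.+1%:R * tau); last first.
  by rewrite -nat1r mulrDl mul1r.
by apply: Rintegral_itv_cat => //; rewrite ?mulr_ge0// ler_wpM2r// ler_nat.
Qed.

(** For [s <= s'], cutting the interval from [s] to [L + s'] either at [s'] or at [L + s] shows that
    the two windows differ by two pieces of length [s' - s]. The bound is therefore independent of
    [L]. *)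
Lemma normr_Rintegral_addr_sub f M L s s' : bounded_measurable f ->
  (forall t, `|f t| <= M) -> 0 <= L ->
  `|\int[mu]_(t in `[0, L]) f (t + s) - \int[mu]_(t in `[0, L]) f (t + s')| <=
  2 * M * `|s - s'|.
Proof.
move=> bf fM L0; wlog ss' : s s' / s <= s'.
  move=> H; have [/H//|/ltW/H] := leP s s'.
  by rewrite distrC (distrC s').
rewrite !Rintegral_itv_addr// !add0r (distrC s).
rewrite (ger0_norm (x := s' - s)) ?subr_ge0//.
have sLs : s <= L + s by rewrite lerDr.
have s'Ls' : s' <= L + s' by rewrite lerDr.
have LsLs' : L + s <= L + s' by rewrite lerD2l.
have := Rintegral_itv_cat bf sLs LsLs'.
rewrite (Rintegral_itv_cat bf ss' s'Ls').
have := normr_Rintegral_itv bf fM ss'; rewrite ler_norml => /andP[? ?].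
have := normr_Rintegral_itv bf fM LsLs'; rewrite ler_norml => /andP[? ?] ?.
by rewrite ler_norml; apply/andP; split; lra.
Qed.

(** Moving the starting point costs a boundary term bounded in [n], which the factor [1 / n]
    removes. *)
Lemma cvg_average_addr f (tau c s s' : R) : 0 < tau -> bounded_measurable f ->
  n%:R^-1 * (tau^-1 * \int[mu]_(t in `[0, n%:R * tau]) f (t + s))
    @[n --> \oo] --> c ->
  n%:R^-1 * (tau^-1 * \int[mu]_(t in `[0, n%:R * tau]) f (t + s'))
    @[n --> \oo] --> c.
Proof.
move=> tau0 bf fc; have [_ [M fM]] := (bounded_measurableP f).1 bf.
pose D := tau^-1 * (2 * M * `|s' - s|).
apply/cvgrPdist_le => e e0; near=> n.
have n0 : 0 < n%:R :> R by near: n; exists 1%N => // j /=; rewrite ltr0n.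
have := normr_Rintegral_addr_sub s' s bf fM (mulr_ge0 (ltW n0) (ltW tau0)).
set J := \int[mu]_(t in _) f (t + s); set J' := \int[mu]_(t in _) f (t + s').
move=> JJ'; have Jc : `|c - n%:R^-1 * (tau^-1 * J)| <= e / 2.
  by rewrite /J; near: n; move/cvgrPdist_le : fc; apply; rewrite divr_gt0.
have De : n%:R^-1 * D <= e / 2.
  rewrite ler_pdivrMl// -ler_pdivrMr ?divr_gt0//; near: n.
  exact: nbhs_infty_ger.
rewrite (_ : c - _ = (c - n%:R^-1 * (tau^-1 * J)) -
    n%:R^-1 * (tau^-1 * (J' - J))); last by rewrite !mulrBr; ring.
rewrite (le_trans (ler_normB _ _))// [leRHS]splitr lerD//.
rewrite (le_trans _ De)// !normrM !normfV (gtr0_norm n0) (gtr0_norm tau0).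
by rewrite /D !ler_pM2l ?invr_gt0.
Unshelve. all: by end_near. Qed.

(** For periodic [f] the average over [n >= 1] periods equals the average over one period from the
    same start. Its limit does not depend on the start by [cvg_average_addr], so uniqueness of
    limits concludes. *)
Lemma Rintegral_periodic f (tau s : R) : 0 < tau -> bounded_measurable f ->
  (forall t, f (t + tau) = f t) ->
  \int[mu]_(t in `[0, tau]) f (t + s) = \int[mu]_(t in `[0, tau]) f t.
Proof.
move=> tau0 bf ftau; pose J u := \int[mu]_(t in `[0, tau]) f (t + u).
have fk k t : f (t + k%:R * tau) = f t.
  elim: k => [|k IHk]; first by rewrite mul0r addr0.
  by rewrite -nat1r mulrDl mul1r (addrC tau) addrA ftau.
have E u n : n%:R^-1 * (tau^-1 * \int[mu]_(t in `[0, n%:R * tau]) f (t + u)) =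
    n%:R^-1 * (tau^-1 * (n%:R * J u)).
  rewrite (Rintegral_itv_blocks _ (ltW tau0) (bounded_measurable_addr u bf)).
  rewrite (eq_bigr (fun=> J u)) => [|k _].
    by rewrite sumr_const card_ord mulr_natl.
  by apply: eq_Rintegral => t _; rewrite addrAC fk.
have cvgJ u : n%:R^-1 * (tau^-1 * \int[mu]_(t in `[0, n%:R * tau]) f (t + u))
    @[n --> \oo] --> tau^-1 * J u.
  (* The index 0 is excluded because there the inverse defaults to 0. *)
  apply: cvg_near_cst; exists 1%N => // n /= n0; rewrite E.
  by field; rewrite pnatr_eq0 -lt0n n0 gt_eqF.
have J0s : tau^-1 * J s = tau^-1 * J 0.
  apply/esym/(cvg_unique (@Rhausdorff R) (cvgJ 0)).
  exact: cvg_average_addr 0 tau0 bf (cvgJ s).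
have /mulfI/(_ _ _ J0s) : tau^-1 != 0 by rewrite invr_eq0 gt_eqF.
by rewrite /J; under [RHS]eq_Rintegral do rewrite addr0.
Qed.

(** With [n] the integer part of [T / tau], the interval from [n * tau] to [T] is shorter than [tau]
    and contributes a bounded amount, negligible after division by [T]. *)
Lemma cvg_time_average f (tau c : R) : 0 < tau -> bounded_measurable f ->
  n%:R^-1 * (tau^-1 * \int[mu]_(t in `[0, n%:R * tau]) f t)
    @[n --> \oo] --> c ->
  T^-1 * \int[mu]_(t in `[0, T]) f t @[T --> +oo] --> c.
Proof.
move=> tau0 bf fc; have [_ [M fM]] := (bounded_measurableP f).1 bf.
apply/cvgrPdist_le => e e0.
have [N _ hN] : \forall n \near \oo, `|c - n%:R^-1 *
    (tau^-1 * \int[mu]_(t in `[0, n%:R * tau]) f t)| <= e / 2.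
  by move/cvgrPdist_le : fc; apply; rewrite divr_gt0.
have M0 : 0 <= M := le_trans (normr_ge0 _) (fM 0).
near=> T; have T0 : 0 < T by near: T; exact: nbhs_pinfty_gt.
(* The successor makes [n] positive as well as beyond [N]. *)
have TN : N.+1%:R <= T / tau.
  by rewrite ler_pdivlMr//; near: T; exact: nbhs_pinfty_ge.
pose n := Num.truncn (T / tau).
have /andP[nT Tn] : n%:R <= T / tau < n.+1%:R.
  by apply: truncn_itv; rewrite divr_ge0// ltW.
have Nn : (N < n)%N by rewrite -ltnS -(ltr_nat R) (le_lt_trans TN).
have n0 : 0 < n%:R :> R by rewrite ltr0n (leq_ltn_trans _ Nn).
rewrite ler_pdivlMr// in nT; rewrite ltr_pdivrMr// -nat1r mulrDl mul1r in Tn.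
have ntau0 : 0 <= n%:R * tau by rewrite mulr_ge0 ?ltW.
have := hN n (ltnW Nn).
rewrite (Rintegral_itv_cat bf ntau0 nT).
have := normr_Rintegral_itv bf fM nT.
set J' := \int[mu]_(t in `[_, T]) f t; set J := \int[mu]_(t in _) f t => J'M cJ.
have {}cJ : `|c * (n%:R * tau) - J| <= e / 2 * T.
  rewrite (_ : _ - _ = (c - n%:R^-1 * (tau^-1 * J)) * (n%:R * tau)); last first.
    by field; rewrite !gt_eqF.
  by rewrite normrM (ger0_norm ntau0) ler_pM.
have {}J'M : `|J'| <= M * tau.
  by rewrite (le_trans J'M)// ler_wpM2l// lerBlDl addrC ltW// addrC.
have cT : `|c * (T - n%:R * tau)| <= `|c| * tau.
  rewrite normrM ler_wpM2l// ger0_norm ?subr_ge0//.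
  by rewrite lerBlDl addrC ltW// addrC.
have eT : (`|c| + M) * tau <= e / 2 * T.
  by rewrite -ler_pdivrMl ?divr_gt0//; near: T; exact: nbhs_pinfty_ge.
(* The three terms are the error on whole periods, the missing part of [c * T], and the integral
   over the last incomplete period. *)
rewrite (_ : c - _ = T^-1 *
  ((c * (n%:R * tau) - J) + c * (T - n%:R * tau) - J')); last first.
  by field; rewrite gt_eqF.
rewrite normrM ger0_norm ?invr_ge0 ?(ltW T0)// ler_pdivrMl//.
rewrite (le_trans (ler_normB _ _))//.
rewrite (le_trans (lerD (ler_normD _ _) (lexx _)))//.
by rewrite mulrDl in eT; lra.
Unshelve. all: by end_near. Qed.

End time_averages.

(** * Almost everywhere equality and iterated integrals *)

Section measurable_sections.
Context d1 d2 (T1 : measurableType d1) (T2 : measurableType d2) (R : realType).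
Variable m2 : {sigma_finite_measure set T2 -> \bar R}.

(** No integrability is assumed: Tonelli applies separately to the positive and negative parts of
    [h] extended by 0 off [D]. *)
Lemma measurable_Rintegral (D : set T2) (h : T1 * T2 -> R) :
  measurable D -> measurable_fun [set: T1 * T2] h ->
  measurable_fun [set: T1] (fun x => \int[m2]_(y in D) h (x, y)).
Proof.
move=> mD mh; pose g := (EFin \o h) \_ (setT `*` D).
have mg : measurable_fun [set: T1 * T2] g.
  apply: (measurable_restrictT _ (measurableX measurableT mD)).1.
  by apply: measurable_funTS; apply/measurable_EFinP.
have -> : (fun x => \int[m2]_(y in D) h (x, y)) =
    fine \o (fun x => \int[m2]_y g (x, y))%E.
  apply/funext => x; rewrite /Rintegral integral_mkcond/=; congr fine.
  by apply: eq_integral => y _; rewrite /g !patchE in_setX in_setT.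
apply: measurableT_comp; first exact: (@fine_measurable R setT).
under eq_fun do rewrite integralE.
apply: emeasurable_funB.
- under eq_fun do (under eq_integral do rewrite funepos_comp).
  exact: (measurable_fun_fubini_tonelli_F _ (measurable_funepos mg)).
- under eq_fun do (under eq_integral do rewrite funeneg_comp).
  exact: (measurable_fun_fubini_tonelli_F _ (measurable_funeneg mg)).
Qed.

End measurable_sections.

(** Tolerances [1 / (k + 1)] express convergence by countable operations. *)
Lemma measurable_cvg_to d (T : measurableType d) (R : realType)
    (u : nat -> T -> R) (c : R) :
  (forall n, measurable_fun [set: T] (u n)) ->
  measurable [set x | u n x @[n --> \oo] --> c].
Proof.
move=> mu; rewrite (_ : [set _ | _] = \bigcap_k \bigcup_N \bigcap_n
    [set x | `|c - u (N + n)%N x| <= k.+1%:R^-1]).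
  apply: bigcap_measurable => // k _; apply: bigcup_measurable => N _.
  apply: bigcap_measurable => // n _.
  have mcu : measurable_fun [set: T] (fun x => `|c - u (N + n)%N x|).
    exact: (measurableT_comp (@normr_measurable R setT)
      (measurable_funB (measurable_cst c) (mu _))).
  have := mcu measurableT _ (measurable_itv `]-oo, (k.+1%:R^-1 : R)]).
  by rewrite setTI; congr (measurable _); apply/seteqP; split => x /=;
    rewrite in_itv.
apply/seteqP; split => x /=.
  move=> /cvgrPdist_le uc k _.
  have [|N _ hN] := uc k.+1%:R^-1; first by rewrite invr_gt0.
  by exists N => // n _; apply: hN; rewrite /= leq_addr.
move=> uc; apply/cvgrPdist_le => e e0.
have [N _ hN] := uc (Num.bound e^-1) I; exists N => // n /= Nn.
have := hN (n - N)%N I; rewrite /= subnKC// => /le_trans; apply.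
rewrite invf_ple ?posrE// (le_trans (ltW (archi_boundP _))) ?invr_ge0 ?ltW//.
by rewrite ltr_nat.
Qed.

Lemma ae_eq_measure d (T : measurableType d) (R : realType)
    (m : {measure set T -> \bar R}) (A B : set T) :
  measurable A -> measurable B -> {ae m, forall x, A x <-> B x} -> m A = m B.
Proof.
move=> mA mB AB; rewrite -[A]setIT -[B]setIT -!integral_indic//.
apply: ae_eq_integral => //.
- by apply/measurable_EFinP; exact: measurable_indic.
- by apply/measurable_EFinP; exact: measurable_indic.
apply: filterS AB => x [AB BA] _; rewrite !indicE; congr (nat_of_bool _)%:R%:E.
by apply/idP/idP => /set_mem ?; apply/mem_set; [exact: AB|exact: BA].
Qed.

Lemma ae_eq_Rintegral d (T : measurableType d) (R : realType)
    (m : {measure set T -> \bar R}) (f g : T -> R) :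
  measurable_fun [set: T] f -> measurable_fun [set: T] g ->
  {ae m, forall x, f x = g x} -> \int[m]_x f x = \int[m]_x g x.
Proof.
move=> mf mg fg; rewrite /Rintegral; congr fine; apply: ae_eq_integral => //.
- exact/measurable_EFinP.
- exact/measurable_EFinP.
- by apply: filterS fg => x -> _.
Qed.

(** A bounded function is integrable on the finite-measure set [D] times [T2]. All inner integrals
    are finite, so [fine] loses nothing. *)
Lemma Rintegral_Fubini d1 d2 (T1 : measurableType d1) (T2 : measurableType d2)
    (R : realType) (m1 : {sigma_finite_measure set T1 -> \bar R})
    (m2 : {sigma_finite_measure set T2 -> \bar R}) (D : set T1)
    (h : T1 * T2 -> R) :
  measurable D -> (m1 D < +oo)%E -> (m2 setT < +oo)%E ->
  bounded_measurable h ->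
  \int[m2]_y \int[m1]_(x in D) h (x, y) =
  \int[m1]_(x in D) \int[m2]_y h (x, y).
Proof.
move=> mD D1 T2oo bh; pose g := (EFin \o h) \_ (D `*` setT).
have mDT : measurable (D `*` [set: T2]) by exact: measurableX.
have ig : (m1 \x m2)%E.-integrable setT g.
  apply: (integrable_mkcond _ mDT).1.
  apply: bounded_measurable_integrable => //.
  by rewrite [ltLHS]product_measure1E// lte_mul_pinfty// ge0_fin_numE.
have i1 y : m1.-integrable D (EFin \o (fun x => h (x, y))).
  apply: bounded_measurable_integrable => //.
  exact: (bounded_measurable_comp (pair2_measurable y) bh).
have i2 x : m2.-integrable setT (EFin \o (fun y => h (x, y))).
  apply: bounded_measurable_integrable => //.
  exact: (bounded_measurable_comp (pair1_measurable x) bh).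
have := Fubini ig; rewrite /Rintegral => gE; congr fine.
transitivity (\int[m2]_y \int[m1]_x g (x, y))%E.
  apply: eq_integral => y _.
  rewrite fineK; last exact: integrable_fin_num (i1 y).
  rewrite integral_mkcond; apply: eq_integral => x _.
  by rewrite /g !patchE in_setX in_setT andbT.
rewrite -gE [RHS]integral_mkcond; apply: eq_integral => x _.
rewrite patchE; case: ifPn => xD.
  rewrite fineK; last exact: integrable_fin_num (i2 x).
  by apply: eq_integral => y _; rewrite /g patchE in_setX xD in_setT.
apply: integral0_eq => y _.
by rewrite /g patchE in_setX (negbTE xD).
Qed.

(** * Orbits of a random periodic path *)

Section orbits.
Context d (Omega : measurableType d) (R : realType) (P : probability Omega R).
Context (theta : metric_dynamical_system P) (X : completeNormedModType R).
Context (Phi : random_dynamical_system theta X) (tau : R).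
Variables (Y : random_periodic_path Phi tau) (tau_gt0 : 0 < tau).
Local Notation mu := (@lebesgue_measure R).
Local Notation Theta := (skew_product Phi).
Implicit Types (s t : R) (p : Omega * borel X) (xi : Omega * borel X -> R).

Definition orbit s w : Omega * borel X := (theta s w, Y s w).

Lemma measurable_theta s : measurable_fun [set: Omega] (theta s).
Proof.
exact: (measurableT_comp (measurable_shift theta) (pair1_measurable s)).
Qed.

Lemma measurable_orbit2 :
  measurable_fun [set: R * Omega] (fun q => orbit q.1 q.2).
Proof.
apply: measurable_fun_pair; [exact: measurable_shift|exact: measurable_rpath].
Qed.

(* [`|t|] makes the skew product measurable on the whole line without
   affecting nonnegative times. *)
Lemma measurable_skew_product2 : measurable_fun [set: R * (Omega * borel X)]
  (fun q => Theta `|q.1| q.2).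
Proof.
have m1 : measurable_fun [set: R * (Omega * borel X)] (fun q => `|q.1|).
  by apply: measurableT_comp => //; exact: normr_measurable.
have m21 : measurable_fun [set: R * (Omega * borel X)] (fun q => q.2.1).
  exact: measurableT_comp.
have m22 : measurable_fun [set: R * (Omega * borel X)] (fun q => q.2.2).
  exact: measurableT_comp.
apply: measurable_fun_pair.
  exact: (measurableT_comp (measurable_shift theta)
    (measurable_fun_pair m1 m21)).
apply: (measurable_comp _ _ (measurable_flow Phi)
  (measurable_fun_pair (measurable_fun_pair m1 m21) m22)).
- have mf : measurable_fun [set: R * Omega * borel X]
      (fun q => q.1.1 : R) by exact: measurableT_comp.
  have := mf measurableT _ (measurable_itv `[(0:R), +oo[).
  by rewrite setTI; congr (measurable _); apply/seteqP; split => q /=;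
    rewrite in_itv/= andbT.
- by move=> _ [q _ <-] /=.
Qed.

Lemma measurable_skew_product t : 0 <= t ->
  measurable_fun [set: Omega * borel X] (Theta t).
Proof.
move=> t0; rewrite -(ger0_norm t0).
exact: (measurableT_comp measurable_skew_product2 (pair1_measurable t)).
Qed.

(** The cocycle law holds only almost surely, so the semigroup law of the skew product is a property
    of the point. *)
Definition semiflow_at p := Theta 0 p = p /\
  forall t s, 0 <= t -> 0 <= s -> Theta t (Theta s p) = Theta (t + s) p.

Lemma ae_semiflow : {ae P, forall w, forall x, semiflow_at (w, x)}.
Proof.
apply: filterS (flow_cocycle Phi) => w [Phi0 Phiw] x; split.
  by rewrite /skew_product /= Defs.shift0 Phi0.
move=> t s t0 s0.
by rewrite /skew_product /= shiftD (Phiw t s t0 s0).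
Qed.

Lemma ae_orbit : {ae P, forall w,
  (forall t s, 0 <= t -> Theta t (orbit s w) = orbit (t + s) w) /\
  (forall s, orbit (s + tau) w = orbit s (theta tau w))}.
Proof.
apply: filterS (rpath_periodic Y) => w [Yw Ytau]; split.
  by move=> t s t0; rewrite /skew_product /orbit /= shiftD Yw.
by move=> s; rewrite /orbit shiftD Ytau.
Qed.

Lemma periodic_measure_setT s : periodic_measure Y s setT = 1%E.
Proof.
by rewrite periodic_measureE// /pushforward preimage_setT probability_setT.
Qed.

HB.instance Definition _ s := Measure_isProbability.Build _ _ _
  (periodic_measure Y s) (periodic_measure_setT s).

Lemma periodic_meanE s xi : bounded_measurable xi ->
  periodic_mean Y s xi = \int[P]_w xi (orbit s w).
Proof.
move=> bxi; have [mxi _] := bxi; have mo := measurable_orbit Y s.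
rewrite /periodic_mean /Rintegral; congr fine.
have := @integral_pushforward _ _ _ _ _ _ mo P setT (EFin \o xi).
rewrite preimage_setT => <-//; last 2 first.
- exact/measurable_EFinP.
- apply: (@bounded_measurable_integrable _ _ _ P setT (xi \o orbit s)) => //.
    exact: le_lt_trans (probability_le1 P measurableT) (ltry _).
  exact: bounded_measurable_comp.
by apply: eq_measure_integral => A mA _; exact: periodic_measureE.
Qed.

(** The measure at time [s] is the law of [orbit s] under [P], so its null sets pull back to null
    sets. *)
Lemma ae_periodic_measure s (Q : Omega * borel X -> Prop) :
  {ae periodic_measure Y s, forall p, Q p} -> {ae P, forall w, Q (orbit s w)}.
Proof.
move=> [A [mA A0 QA]]; exists (orbit s @^-1` A); split.
- by rewrite -[X in measurable X]setTI; exact: measurable_orbit.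
- exact: etrans (esym (periodic_measureE Y s mA)) A0.
- by move=> w; exact: QA.
Qed.

(** Almost surely [Theta tau] sends [orbit s w] to [orbit (s + tau) w], which is
    [orbit s (theta tau w)]; invariance of [P] under [theta tau] then transfers. *)
Lemma periodic_measure_preserved s A : measurable A ->
  periodic_measure Y s (Theta tau @^-1` A) = periodic_measure Y s A.
Proof.
move=> mA; have mT := measurable_skew_product (ltW tau_gt0).
have mTA : measurable (Theta tau @^-1` A).
  by rewrite -[X in measurable X]setTI; exact: mT.
have mo B : measurable B -> measurable (orbit s @^-1` B).
  by move=> mB; rewrite -[X in measurable X]setTI; exact: measurable_orbit.
rewrite !periodic_measureE// /pushforward -!/(orbit s).
have /esym := shift_preserves theta tau (mo _ mA).
rewrite /pushforward => ->; apply: ae_eq_measure.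
- exact: mo.
- rewrite -[X in measurable X]setTI.
  by apply: measurable_theta => //; exact: mo.
apply: filterS ae_orbit => w [Tw tw]; rewrite /preimage /= Tw ?ltW//.
by rewrite addrC tw.
Qed.

Lemma periodic_mean_periodic s xi : bounded_measurable xi ->
  periodic_mean Y (s + tau) xi = periodic_mean Y s xi.
Proof.
move=> bxi; rewrite !periodic_meanE//.
have bo u : bounded_measurable (xi \o orbit u).
  by apply: bounded_measurable_comp bxi; exact: measurable_orbit.
have pres A : measurable A -> P (theta tau @^-1` A) = P A.
  exact: shift_preserves.
rewrite -(Rintegral_preserved (measurable_theta tau) pres (bo s)).
apply: ae_eq_Rintegral.
- exact: (bo _).1.
- exact: (bounded_measurable_comp (measurable_theta tau) (bo s)).1.
by apply: filterS ae_orbit => w [_ tw]; rewrite /= tw.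
Qed.

Section averages.
Variables (xi : Omega * borel X -> R) (bxi : bounded_measurable xi).

Definition skew_average p : R :=
  tau^-1 * \int[mu]_(t in `[0, tau]) xi (Theta `|t| p).

Lemma bounded_measurable_skew p :
  bounded_measurable (fun t : R => xi (Theta `|t| p)).
Proof.
apply: (@bounded_measurable_comp _ _ R _ _ xi (fun t : R => Theta `|t| p)) bxi.
exact: (measurableT_comp measurable_skew_product2 (pair2_measurable p)).
Qed.

Lemma bounded_measurable_orbit w :
  bounded_measurable (fun t : R => xi (orbit t w)).
Proof.
apply: (@bounded_measurable_comp _ _ R _ _ xi (orbit^~ w)) bxi.
exact: (measurableT_comp measurable_orbit2 (pair2_measurable w)).
Qed.

Lemma bounded_measurable_mean :
  bounded_measurable (fun s : R => periodic_mean Y s xi).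
Proof.
have bxi' := (bounded_measurableP xi).1 bxi; have [mxi [M xiM]] := bxi'.
have -> : (fun s => periodic_mean Y s xi) =
    (fun s => \int[P]_w xi (orbit s w)).
  by apply/funext => s; rewrite periodic_meanE.
apply/bounded_measurableP; split.
  apply: (@measurable_Rintegral _ _ R _ _ P setT
    (fun q => xi (orbit q.1 q.2))) => //.
  exact: (measurableT_comp mxi measurable_orbit2).
exists M => s.
have bo : bounded_measurable (xi \o orbit s).
  by apply: bounded_measurable_comp bxi; exact: measurable_orbit.
have Poo : (P setT < +oo)%E.
  exact: le_lt_trans (probability_le1 P measurableT) (ltry _).
have io := bounded_measurable_integrable measurableT Poo bo.
rewrite (le_trans (le_normr_Rintegral measurableT io))//.
have -> : M = \int[P]_w M.
  by rewrite Rintegral_cst// [X in fine X]probability_setT mulr1.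
apply: le_Rintegral => //.
- exact: integrable_norm.
- exact: (bounded_measurable_integrable measurableT Poo
    (bounded_measurable_cst _ M)).
- by move=> w _; exact: xiM.
Qed.

Lemma bounded_measurable_skew_average : bounded_measurable skew_average.
Proof.
have [mxi [M xiM]] := (bounded_measurableP xi).1 bxi.
apply/bounded_measurableP; split.
  apply: measurable_funM => //.
  apply: (@measurable_Rintegral _ _ _ (measurableTypeR R) _ mu `[0, tau]
    (fun q => xi (Theta `|q.2| q.1))) => //.
  apply: (measurableT_comp mxi).
  exact: (measurableT_comp measurable_skew_product2
    (measurable_fun_pair measurable_snd measurable_fst)).
exists M => p; rewrite normrM normfV (gtr0_norm tau_gt0) ler_pdivrMl//.
rewrite [leRHS]mulrC.
have := normr_Rintegral_itv (bounded_measurable_skew p) (fun t => xiM _)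
  (ltW tau_gt0).
by rewrite subr0.
Qed.

(** By the semigroup law the [k]-th iterate of [Theta tau] is the skew product at time [k * tau], so
    the [k]-th summand is the integral over the [k]-th period. *)
Lemma birkhoff_sum_skew_average p n : semiflow_at p ->
  birkhoff_sum (Theta tau) skew_average n p =
  tau^-1 * \int[mu]_(t in `[0, n%:R * tau]) xi (Theta `|t| p).
Proof.
move=> sp; have tau0 := ltW tau_gt0.
rewrite (Rintegral_itv_blocks _ tau0 (bounded_measurable_skew p)).
rewrite mulr_sumr; apply: eq_bigr => k _; congr (_ * _).
have iterE j : iter j (Theta tau) p = Theta (j%:R * tau) p.
  elim: j => [|j IHj]; first by rewrite mul0r sp.1.
  by rewrite iterS IHj sp.2 ?mulr_ge0// -nat1r mulrDl mul1r.
apply: eq_Rintegral => t; rewrite inE/= in_itv/= => /andP[t0 _].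
have kt0 : 0 <= k%:R * tau by rewrite mulr_ge0.
by rewrite iterE (ger0_norm t0) sp.2// ger0_norm ?addr_ge0.
Qed.

(** Fubini turns the mean of the averages along [orbit s] into an average of means over times from
    [s] to [s + tau]; periodicity of the means removes [s]. *)
Lemma periodic_mean_skew_average s : periodic_mean Y s skew_average =
  tau^-1 * \int[mu]_(t in `[0, tau]) periodic_mean Y t xi.
Proof.
rewrite periodic_meanE; last exact: bounded_measurable_skew_average.
(* The window on the right is first moved to start at [s]. *)
rewrite -(Rintegral_periodic s tau_gt0 bounded_measurable_mean); last first.
  by move=> t; exact: periodic_mean_periodic.
pose h (q : R * Omega) := xi (orbit (q.1 + s) q.2).
have bh : bounded_measurable h.
  apply: (@bounded_measurable_comp _ _ (R * Omega)%type _ _ xi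
    (fun q => orbit (q.1 + s) q.2)) bxi.
  exact: (measurableT_comp measurable_orbit2 (measurable_fun_pair
    (measurable_funD measurable_fst (measurable_cst s)) measurable_snd)).
have muoo : (mu `[0%R, tau] < +oo)%E.
  by rewrite lebesgue_measure_itv/=; case: ifP => _; rewrite ltry.
have Poo : (P setT < +oo)%E.
  exact: le_lt_trans (probability_le1 P measurableT) (ltry _).
have mh := @measurable_Rintegral _ _ Omega (measurableTypeR R) R mu `[0, tau]
  (fun q => h (q.2, q.1)) (measurable_itv _)
  (measurableT_comp bh.1 (measurable_fun_pair measurable_snd measurable_fst)).
transitivity (\int[P]_w (tau^-1 * \int[mu]_(t in `[0, tau]) h (t, w))).
  apply: ae_eq_Rintegral.
  - exact: (bounded_measurable_comp (measurable_orbit Y s)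
      bounded_measurable_skew_average).1.
  - exact: measurable_funM.
  apply: filterS ae_orbit => w [Tw _]; congr (_ * _).
  apply: eq_Rintegral => t; rewrite inE/= in_itv/= => /andP[t0 _].
  by rewrite ger0_norm// Tw.
rewrite RintegralZl//; last first.
  apply: bounded_measurable_integrable => //; apply/bounded_measurableP.
  split=> //; have [_ [M hM]] := (bounded_measurableP h).1 bh.
  exists (M * (tau - 0)) => w.
  apply: (@normr_Rintegral_itv _ (fun t => h (t, w))) => //; last exact: ltW.
  exact: (bounded_measurable_comp (pair2_measurable w) bh).
congr (_ * _).
rewrite (@Rintegral_Fubini _ _ (measurableTypeR R) Omega R mu P)//.
by apply: eq_Rintegral => t _; rewrite periodic_meanE.
Qed.

(** On an orbit the semigroup law follows from the orbit relation itself, for all [s] at once. *)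
Lemma semiflow_at_orbit w :
  (forall t s, 0 <= t -> Theta t (orbit s w) = orbit (t + s) w) ->
  forall s, semiflow_at (orbit s w).
Proof.
move=> Tw s; split; first by rewrite Tw// add0r.
by move=> t u t0 u0; rewrite !Tw ?addr_ge0// addrA.
Qed.

(* Ergodicity at the single time [s0] suffices: the averages along an orbit
   started at times [s0] and [s] differ by a boundary term of order [1 / n]. *)
Lemma ae_cvg_skew_average s0 s :
  ergodic (periodic_measure Y s0) (Theta tau) ->
  {ae P, forall w,
    n%:R^-1 * birkhoff_sum (Theta tau) skew_average n (orbit s w)
      @[n --> \oo] -->
    tau^-1 * \int[mu]_(t in `[0, tau]) periodic_mean Y t xi}.
Proof.
move=> erg.
have := @birkhoff_ergodic _ _ R (periodic_measure Y s0) _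
  (measurable_skew_product (ltW tau_gt0)) (@periodic_measure_preserved s0)
  _ erg bounded_measurable_skew_average.
rewrite -/(periodic_mean Y s0 _) periodic_mean_skew_average.
move/ae_periodic_measure; apply: filterS2 ae_orbit => w [Tw _].
(* For every start [u] the sums are windows of one function [t |-> xi (orbit t w)], so
   [cvg_average_addr] applies with [s0] and [s]. *)
have E u n : n%:R^-1 * birkhoff_sum (Theta tau) skew_average n (orbit u w) =
    n%:R^-1 * (tau^-1 * \int[mu]_(t in `[0, n%:R * tau]) xi (orbit (t + u) w)).
  rewrite birkhoff_sum_skew_average; last exact: semiflow_at_orbit.
  congr (_ * (_ * _)); apply: eq_Rintegral => t.
  by rewrite inE/= in_itv/= => /andP[t0 _]; rewrite ger0_norm// Tw.
under eq_cvg do rewrite E; under [X in _ -> X]eq_cvg do rewrite E.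
exact: cvg_average_addr (bounded_measurable_orbit w).
Qed.

End averages.
End orbits.

(** * Quasi-sure convergence of the continuous-time averages *)

Theorem proposition4p5 (d : measure_display) (Omega : measurableType d)
    (R : realType) (P : probability Omega R)
    (theta : metric_dynamical_system P)
    (X : completeNormedModType R) (Xsep : separable X)
    (Phi : random_dynamical_system theta X)
    (tau : R) (tau_gt0 : 0 < tau)
    (Y : random_periodic_path Phi tau)
    (Yerg : exists s : R,
      ergodic (periodic_measure Y s) (skew_product Phi tau))
    (xi : Omega * borel X -> R) (xi_Lb : bounded_measurable xi) :
  quasi_surely Y (fun p =>
    T^-1 * (\int[lebesgue_measure]_(t in `[0, T]) koopman Phi t xi p)
      @[T --> +oo]
    --> tau^-1 * (\int[lebesgue_measure]_(s in `[0, tau])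
                    periodic_mean Y s xi)).
Proof.
have [s0 erg] := Yerg; set c := tau^-1 * _.
have [N [mN N0 Nflow]] := ae_semiflow Phi.
pose avg n := birkhoff_sum (skew_product Phi tau) (skew_average Phi tau xi) n.
(* The good set is described by discrete averages, for which measurability is a countable matter;
   avoiding [N] secures the semigroup law. *)
pose A := [set p : Omega * borel X | ~ N p.1] `&`
  [set p | n%:R^-1 * avg n p @[n --> \oo] --> c].
have mtau := measurable_skew_product Phi (ltW tau_gt0).
have mavg n : measurable_fun [set: Omega * borel X] (avg n).
  exact: (bounded_measurable_birkhoff_sum mtau n
    (bounded_measurable_skew_average Phi tau_gt0 xi_Lb)).1.
have mA : measurable A.
  apply: measurableI.
    have mfst : measurable_fun [set: Omega * borel X] (@fst Omega (borel X)).
      exact: measurable_fst.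
    by have := mfst measurableT _ (measurableC mN); rewrite setTI.
  apply: (measurable_cvg_to (u := fun n p => n%:R^-1 * avg n p)) => n.
  exact: measurable_funM.
exists A; split => //.
  rewrite /upper_expectation (_ : [set _ | _ in _] = [set 0]) ?sup1//.
  suff mean0 s : periodic_mean Y s \1_(~` A) = 0.
    apply/seteqP; split => [_ [s _ <-]|_ ->] /=; first exact: mean0.
    (* Time 0 belongs to the index interval, so the set of means is exactly [[set 0]], with supremum
       0. *)
    by exists 0; [rewrite /= in_itv/= lexx|exact: mean0].
  rewrite /periodic_mean /Rintegral integral_indic//; last exact: measurableC.
  rewrite setIT [X in fine X](periodic_measureE Y s (measurableC mA)).
  rewrite (_ : pushforward _ _ _ = 0%E)// /pushforward.
  apply: (@measure_negligible _ _ _ P).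
    rewrite -[X in measurable X]setTI; apply: measurable_orbit => //.
    exact: measurableC.
  (* The first coordinate of [orbit s w] is [theta s w], and [theta s] preserves [P]. *)
  have Ns : {ae P, forall w, ~ N (theta s w)}.
    exists (theta s @^-1` N); split.
    - by rewrite -[X in measurable X]setTI; exact: measurable_theta.
    - exact: etrans (shift_preserves theta s mN) N0.
    - by move=> w /= /contrapT.
  have := ae_cvg_skew_average tau_gt0 xi_Lb s erg.
  move: Ns; rewrite /A; apply: filterS2 => w Nw cw.
  by split; [exact: Nw|exact: cw].
move=> p [Np cp].
have sp : semiflow_at Phi p.
  apply: contrapT => sp; apply/Np/Nflow => /(_ p.2).
  by rewrite -surjective_pairing.
have bp := bounded_measurable_skew Phi xi_Lb p.
have avgE n := birkhoff_sum_skew_average tau_gt0 xi_Lb n sp.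
have : n%:R^-1 * (tau^-1 * \int[lebesgue_measure]_(t in `[0, n%:R * tau])
    xi (skew_product Phi `|t| p)) @[n --> \oo] --> c.
  by under eq_cvg do rewrite -avgE.
move/(cvg_time_average tau_gt0 bp).
(* On the domain of integration [|t|] is [t], which recovers [koopman]. *)
apply: cvg_trans; apply: near_eq_cvg; near=> T; congr (_ * _).
apply: eq_Rintegral => t; rewrite inE/= in_itv/= => /andP[t0 _].
by rewrite ger0_norm.
Unshelve. all: by end_near. Qed.
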